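(* Let $C$ be a copula and let $c(x,y)$ be the density of the absolutely continuous part of $C$. Suppose there exist nonnegative functions $\varepsilon_1,\varepsilon_2\in L^1[0,1]$, at least one of which has a non-zero integral over $[0,1]$, such that $$c(x,y)\ge \varepsilon_1(x)+\varepsilon_2(y)$$ for almost every $(x,y)\in[0,1]^2$. Then the stationary Markov chain generated by $C$ is exponentially $\rho$-mixing.
   Context: A (2-)copula is a function $C:[0,1]^2\to[0,1]$ that is the joint cumulative distribution function of two random variables each uniform on $[0,1]$; it corresponds to a probability measure on $[0,1]^2$, and the density of its absolutely continuous part is the density, with respect to Lebesgue measure, of the absolutely continuous part (Lebesgue decomposition) of this measure. A stationary Markov chain $(X_n)_{n\in\mathbb Z}$ is generated by $C$ if its one-dimensional marginal distribution is uniform on $[0,1]$ and $(X_n,X_{n+1})$ has joint distribution function $C$, i.e. $P(X_{n+1}\le y\mid X_n=x)=\partial C(x,y)/\partial x$ for almost every $x$. For $\sigma$-fields $\mathscr A,\mathscr B$ put $\rho(\mathscr A,\mathscr B)=\sup\{\mathrm{corr}(f,g): f\in L^2(\mathscr A), g\in L^2(\mathscr B)\}$, and let $\rho_n=\rho(\sigma(X_i,i\le0),\sigma(X_i,i\ge n))$. The chain is exponentially $\rho$-mixing if $\rho_n\to 0$ at an exponential rate, i.e. $\rho_n\le K r^n$ for all $n\ge1$ for some $K<\infty$, $r\in(0,1)$. *)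

(* Defs.v *)
From HB Require Import structures.
From mathcomp Require Export all_boot all_order all_algebra.
From mathcomp Require Export all_classical all_reals all_analysis.

Set Implicit Arguments.
Unset Strict Implicit.
Unset Printing Implicit Defensive.

Import Order.TTheory GRing.Theory Num.Theory.
Import numFieldNormedType.Exports.

Local Open Scope classical_set_scope.
Local Open Scope ring_scope.

Section Copulas.
Context {R : realType}.

Definition unit_itv : set R := `[0, 1].

Definition unit_square : set (R * R) := unit_itv `*` unit_itv.

Definition lebesgue2 := (@lebesgue_measure R \x @lebesgue_measure R)%E.

Definition uniform01 d (T : measurableType d) (P : probability T R)
    (U : {RV P >-> R}) : Prop :=
  forall A : set R, measurable A ->
    distribution P U A = uniform_prob (@ltr01 R) A.

(* [C] stands for a function on the unit square: its values elsewhere are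
   never used. *)
Definition joint_cdf d (T : measurableType d) (P : probability T R)
    (U V : {RV P >-> R}) (C : R -> R -> R) : Prop :=
  forall x y : R, unit_itv x -> unit_itv y ->
    (C x y)%:E = P [set w | U w <= x /\ V w <= y].

Definition copula (C : R -> R -> R) : Prop :=
  exists (d : measure_display) (T : measurableType d) (P : probability T R)
         (U V : {RV P >-> R}),
    [/\ uniform01 U, uniform01 V & joint_cdf U V C].

(* A probability measure on the unit square is encoded as one on the plane that
   gives mass 1 to the square. *)
Definition copula_measure (C : R -> R -> R) (mu : probability (R * R)%type R)
    : Prop :=
  mu unit_square = 1%E /\
  forall x y : R, unit_itv x -> unit_itv y ->
    (C x y)%:E = mu (`]-oo, x] `*` `]-oo, y]).

Definition mutually_singular d (T : measurableType d)
    (m1 m2 : set T -> \bar R) : Prop :=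
  exists N : set T, [/\ measurable N, m1 N = 0%E & m2 (~` N) = 0%E].

(* [mua] and [mus] are the two parts of the Lebesgue decomposition of the
   measure of [C]. *)
Definition ac_density (C : R -> R -> R) (c : R * R -> R) : Prop :=
  exists (mu : probability (R * R)%type R)
         (mua mus : {measure set (R * R)%type -> \bar R}),
    [/\ copula_measure C mu,
        forall A, measurable A -> mu A = (mua A + mus A)%E,
        mua `<< lebesgue2,
        mutually_singular mus lebesgue2 &
        [/\ measurable_fun unit_square c,
            forall z, unit_square z -> 0 <= c z &
            forall A, measurable A ->
              (mua A = \int[lebesgue2]_(z in A `&` unit_square) (c z)%:E)%E]].

End Copulas.

Section Mixing.
Context {R : realType} {d : measure_display} {T : measurableType d}.
Variable P : probability T R.

(* A sub-sigma-field of [T] is represented by its set of events. *)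
Definition measurable_wrt (G : set (set T)) (f : T -> R) : Prop :=
  forall B : set R, measurable B -> G (f @^-1` B).

Definition sigma_of (X : int -> {RV P >-> R}) (I : set int) : set (set T) :=
  <<s \bigcup_(i in I) preimage_set_system setT (X i) measurable >>.

(* [g] is a version of the conditional probability of [E] given [G]. *)
Definition is_cond_prob (G : set (set T)) (E : set T) (g : T -> R) : Prop :=
  [/\ measurable_wrt G g,
      P.-integrable setT (EFin \o g) &
      forall A, G A -> (\int[P]_(w in A) (g w)%:E = P (A `&` E))%E].

(* The law of [X_(n+1)] given [X_i], [i <= n], is its law given [X_n]. *)
Definition markov_chain (X : int -> {RV P >-> R}) : Prop :=
  forall (n : int) (B : set R), measurable B ->
    exists2 g : T -> R,
      is_cond_prob (sigma_of X [set n]) (X (n + 1) @^-1` B) g &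
      is_cond_prob (sigma_of X [set i | i <= n]) (X (n + 1) @^-1` B) g.

Definition stationary (X : int -> {RV P >-> R}) : Prop :=
  forall (k : int) (s : seq int) (B : int -> set R),
    (forall i, measurable (B i)) ->
    P (\bigcap_(i in [set` s]) (X (i + k) @^-1` B i)) =
    P (\bigcap_(i in [set` s]) (X i @^-1` B i)).

Definition generated_by (C : R -> R -> R) (X : int -> {RV P >-> R}) : Prop :=
  [/\ stationary X, markov_chain X,
      forall n, uniform01 (X n) &
      forall n, joint_cdf (X n) (X (n + 1)) C].

Definition L2_of (G : set (set T)) : set (T -> R) :=
  [set f | measurable_wrt G f /\ f \in Lfun P 2%:E].

(* As division by 0 yields 0, a correlation with an almost surely constant
   variable is 0. *)
Definition corr (f g : T -> R) : R :=
  fine (covariance P f g) /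
    (Num.sqrt (fine 'V_P[f]) * Num.sqrt (fine 'V_P[g])).

Definition rho (A B : set (set T)) : \bar R :=
  ereal_sup [set (corr f g)%:E | f in L2_of A & g in L2_of B].

Definition rho_coef (X : int -> {RV P >-> R}) (n : nat) : \bar R :=
  rho (sigma_of X [set i | i <= 0]) (sigma_of X [set i | n%:Z <= i]).

Definition exponentially_rho_mixing (X : int -> {RV P >-> R}) : Prop :=
  exists K r : R, 0 < r < 1 /\
    forall n : nat, (1 <= n)%N -> (rho_coef X n <= (K * r ^+ n)%:E)%E.

End Mixing.

(* Main.v *)
From HB Require Import structures.
From mathcomp Require Import measurable_realfun zify ring lra.
Require Import Defs.

Set Implicit Arguments.
Unset Strict Implicit.
Unset Printing Implicit Defensive.

Import Order.TTheory GRing.Theory Num.Theory.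
Import numFieldNormedType.Exports.
Import HBNNSimple.

Local Open Scope classical_set_scope.
Local Open Scope ring_scope.

(** The lower bound on the density says that, with a positive probability, one of
    two consecutive states is drawn uniformly without regard to the other:
    [eps1 x] is a chance that the next state forgets the present state [x], and
    [eps2 y] is the same backwards in time. This keeps the correlation of
    functions of the two states away from 1. Quantitatively, let [e1] and [e2]
    be the integrals of [eps1] and [eps2], and let [f(X_0)] and [g(X_1)] be
    centred. Then
      E (f(X_0) - g(X_1))^2
        >= int int (f(x) - g(y))^2 (eps1 x + eps2 y) dx dy
        >= e1 Var g(X_1) + e2 Var f(X_0),
    because for fixed [x] the integral over [y] of [(f(x) - g(y))^2] is
    [f(x)^2 + Var g(X_1)]. Expanding the left-hand side gives
      2 Cov(f(X_0), g(X_1)) <= (1 - e2) Var f(X_0) + (1 - e1) Var g(X_1),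
    which is [one_step_covariance]; as [e1 + e2 > 0], it is strictly better than
    what the nonnegativity of a variance gives.

    To pass from one step to [n] steps, take a function [F] of the past with
    values in [0, 1] and its regressions [f_k(X_k)] on the successive states
    ([exists_conditional_mean]). By the Markov property the past influences the
    future after [k] only through [f_k(X_k)] ([markov_future]), so that
      Var f_{k+1}(X_{k+1}) = Cov(F, f_{k+1}(X_{k+1}))
                           = Cov(f_k(X_k), f_{k+1}(X_{k+1})),
    and the one-step inequality becomes
      (1 + e1) Var f_{k+1}(X_{k+1}) <= (1 - e2) Var f_k(X_k).
    The variances thus decay geometrically ([conditional_mean_variance_decay]).
    For a function [G] of the future after [n], Cov(F, G) = Cov(f_n(X_n), G) is
    at most the product of the two standard deviations, the first of which is
    at most [sqrt q ^ n] times that of [F], where [q] bounds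
    [(1 - e2) / (1 + e1)].

    An affine change of variables extends the bound to bounded [F] and [G], and
    truncation extends it to square integrable ones ([rcov_decay]). *)

(** * Measures with a density, and measures on a sub-sigma-field *)

Section Densities.
Context d {T : measurableType d} {R : realType}.
Local Open Scope ereal_scope.
Implicit Types mu m : {measure set T -> \bar R}.

Lemma ge0_integral_density mu m (w : T -> R) (f : T -> \bar R) :
    measurable_fun [set: T] w -> (forall x, (0 <= w x)%R) ->
    (forall A, measurable A -> m A = \int[mu]_(x in A) (w x)%:E) ->
    measurable_fun [set: T] f -> (forall x, 0 <= f x) ->
  \int[m]_x f x = \int[mu]_x (f x * (w x)%:E).
Proof.
move=> mw w0 mE mf f0.
have mEw : measurable_fun [set: T] (EFin \o w) by exact/measurable_EFinP.
have w0' x : 0 <= (w x)%:E by rewrite lee_fin.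
pose h := nnsfun_approx measurableT mf.
(* both sides are monotone limits of their values at simple functions *)
have step n : \int[m]_x (h n x)%:E = \int[mu]_x ((h n x)%:E * (w x)%:E).
  under eq_integral do rewrite fimfunE -fsumEFin//.
  under [RHS]eq_integral => x xE.
    rewrite fimfunE -fsumEFin// ge0_mule_fsuml; last first.
      by move=> y; exact: nnfun_muleindic_ge0.
    over.
  have indich r : measurable_fun [set: T]
      (fun x : T => (r * \1_(h n @^-1` [set r]) x)%:E).
    by apply/measurable_EFinP; exact: measurable_funM.
  rewrite !ge0_integral_fsum//; first last.
  - by move=> r x _; exact: nnfun_muleindic_ge0.
  - by move=> r x _; rewrite mule_ge0// nnfun_muleindic_ge0.
  - by move=> r; apply: emeasurable_funM.
  apply: eq_fsbigr => r rhn.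
  under eq_integral do rewrite EFinM.
  rewrite integralZl_indic_nnsfun// integral_indic// setIT.
  under [RHS]eq_integral do rewrite EFinM -muleA.
  rewrite ge0_integralZl//; first last.
  - by move: rhn; rewrite inE => -[t _ <-]; rewrite lee_fin.
  - by move=> x _; rewrite mule_ge0.
  - by apply: emeasurable_funM => //; exact/measurable_EFinP.
  rewrite mE//.
  congr (_ * _).
  under [RHS]eq_integral do rewrite muleC.
  rewrite integral_mkcond; apply: eq_integral => x _.
  by rewrite epatch_indic.
transitivity (limn (fun n => \int[m]_x (h n x)%:E)).
  rewrite -monotone_convergence//=.
  - by apply: eq_integral => x _; apply/esym/cvg_lim => //; exact: cvg_nnsfun_approx.
  - by move=> n; exact/measurable_EFinP.
  - by move=> n x _; rewrite lee_fin.
  - by move=> x _ a b ab; rewrite lee_fin; exact/lefP/nd_nnsfun_approx.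
under eq_fun do rewrite step.
rewrite -monotone_convergence//=.
- apply: eq_integral => x _; apply/cvg_lim => //.
  by apply: cvgeZr => //; exact: cvg_nnsfun_approx.
- by move=> n; apply: emeasurable_funM => //; exact/measurable_EFinP.
- by move=> n x _; rewrite mule_ge0// lee_fin.
- by move=> x _ a b ab; rewrite lee_wpmul2r// lee_fin; exact/lefP/nd_nnsfun_approx.
Qed.

Lemma ge0_integral_density_in mu m (w : T -> R) (D : set T) (f : T -> \bar R) :
    measurable_fun [set: T] w -> (forall x, (0 <= w x)%R) ->
    (forall A, measurable A -> m A = \int[mu]_(x in A) (w x)%:E) ->
    measurable D -> measurable_fun [set: T] f -> (forall x, 0 <= f x) ->
  \int[m]_(x in D) f x = \int[mu]_(x in D) (f x * (w x)%:E).
Proof.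
move=> mw w0 mE mD mf f0.
rewrite integral_mkcond (@ge0_integral_density mu _ w)//; first last.
- by move=> x; apply: erestrict_ge0.
- by apply/(measurable_restrictT _ _).1 => //; exact: measurable_funTS.
rewrite [RHS]integral_mkcond; apply: eq_integral => x _.
by rewrite !patchE; case: ifPn => //; rewrite mul0e.
Qed.

Lemma exists_density mu (w : T -> R) :
    measurable_fun [set: T] w -> (forall x, (0 <= w x)%R) ->
  exists m : {measure set T -> \bar R},
    forall A, m A = \int[mu]_(x in A) (w x)%:E.
Proof.
move=> mw w0.
have mEw : measurable_fun [set: T] (EFin \o w) by exact/measurable_EFinP.
have w0' x : 0 <= (w x)%:E by rewrite lee_fin.
pose m A := \int[mu]_(x in A) (w x)%:E.
have m0 : m set0 = 0 by rewrite /m integral_set0.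
have mge0 A : 0 <= m A by exact: integral_ge0.
have madd : semi_sigma_additive m.
  move=> /= F mF tF mUF; rewrite /m; apply: cvg_toP.
    apply: ereal_nondecreasing_is_cvgn => i j ij.
    by apply: lee_sum_nneg_natr => // k _ _; exact: integral_ge0.
  by rewrite ge0_integral_bigcup//; exact: measurable_funTS.
pose M : {measure set T -> \bar R} := HB.pack m (isMeasure.Build d T R m m0 mge0 madd).
by exists M.
Qed.

Lemma ge0_integral_mrestr mu (D : set T) (mD : measurable D) (f : T -> \bar R) :
    measurable_fun [set: T] f -> (forall x, 0 <= f x) ->
  \int[mrestr mu mD]_x f x = \int[mu]_(x in D) f x.
Proof.
move=> mf f0.
rewrite (@ge0_integral_density mu _ \1_D)//; first last.
- by move=> A mA; rewrite integral_indic// setIC.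
by rewrite [RHS]integral_mkcond; apply: eq_integral => x _; rewrite epatch_indic.
Qed.

(** Only the law of [f] enters its integral. So two measures that agree on a
    sub-sigma-field integrate in the same way every function measurable with
    respect to it: this is how identities between conditional probabilities of
    events become identities between integrals of functions. *)
Lemma ge0_eq_integral_preimage m1 m2 (D : set T) (f : T -> R) :
    measurable D -> measurable_fun [set: T] f -> (forall x, (0 <= f x)%R) ->
    (forall B : set R, measurable B -> m1 (f @^-1` B `&` D) = m2 (f @^-1` B `&` D)) ->
  \int[m1]_(x in D) (f x)%:E = \int[m2]_(x in D) (f x)%:E.
Proof.
move=> mD mf f0 m12.
pose F : {mfun T >-> R} := mfun_Sub (mem_set mf).
(* the absolute value leaves [f] unchanged and is nonnegative on all of [R] *)
have restr m : \int[m]_(x in D) (f x)%:E =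
    \int[pushforward (mrestr m mD) F]_y (`|y|%R)%:E.
  rewrite [RHS]ge0_integral_pushforward//; last exact/measurable_EFinP.
  rewrite preimage_setT ge0_integral_mrestr//=.
  - by apply: eq_integral => x _; rewrite ger0_norm.
  - by apply/measurable_EFinP; exact: measurableT_comp.
rewrite !restr; apply: eq_measure_integral => A mA _; exact: m12.
Qed.

Lemma eq_measure_g_sigma_algebra m1 m2 (G : set (set T)) :
    G `<=` measurable -> setI_closed G -> G setT -> m1 setT < +oo ->
    (forall A, G A -> m1 A = m2 A) ->
  forall A, <<s G >> A -> m1 A = m2 A.
Proof.
move=> Gm GI GT m1oo m12.
apply: (g_sigma_algebra_measure_unique G Gm (fun=> setT)) => //.
by apply/seteqP; split=> // x _; exists 0%N.
Qed.

End Densities.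

(** * Regression on a random variable *)

Section ConditionalExpectation.
Context d {T : measurableType d} {R : realType} (P : probability T R).
Local Open Scope ereal_scope.

Definition unit_valued (U : Type) (f : U -> R) := forall x, (0 <= f x <= 1)%R.

(** [f] is the regression of [F] on [X]: [f \o X] is a version of the
    conditional expectation of [F] given the sigma-field of [X]. *)
Definition conditional_mean (X : {RV P >-> R}) (F : T -> R) (f : R -> R) :=
  forall B : set R, measurable B ->
    \int[P]_(w in X @^-1` B) (F w)%:E = \int[P]_(w in X @^-1` B) (f (X w))%:E.

(** The measure of density [F] has an image under [X] that is bounded above by
    the law of [X]; its Radon-Nikodym derivative is the regression function.
    The derivative is at most 1 almost everywhere only, so it is cut at 1 to
    stay within [0, 1] at every point. *)
Lemma exists_conditional_mean (X : {RV P >-> R}) (F : T -> R) :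
    measurable_fun [set: T] F -> unit_valued F ->
  exists f : R -> R,
    [/\ measurable_fun [set: R] f, unit_valued f & conditional_mean X F f].
Proof.
move=> mF F01.
have F0 x : (0 <= F x)%R by have /andP[] := F01 x.
have mX B : measurable B -> measurable (X @^-1` B) by exact: measurable_funPTI.
have [m mE] := exists_density P mF F0.
have m_le A : measurable A -> m A <= P A.
  move=> mA; rewrite mE -[leRHS]mul1e -integral_cst//.
  apply: ge0_le_integral => //.
  - by move=> x _; rewrite lee_fin.
  - by apply: measurable_funTS; exact/measurable_EFinP.
  - by move=> x _; rewrite lee_fin; have /andP[] := F01 x.
have [nu0 nu0E] : exists nu0 : {measure set R -> \bar R},
    forall B, nu0 B = m (X @^-1` B).
  by unshelve (exists (pushforward m X)) => //; exact: measurable_funP.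
have nu_le B : measurable B -> nu0 B <= distribution P X B.
  by move=> mB; rewrite nu0E; apply: m_le; exact: mX.
have nuT : nu0 setT < +oo.
  by rewrite (le_lt_trans (nu_le _ measurableT))// probability_setT ltry.
pose nu : {finite_measure set R -> \bar R} := mfrestr measurableT nuT.
have nuE B : nu B = nu0 B by rewrite /nu/= /mfrestr /mrestr setIT.
have dom : nu `<< distribution P X.
  apply/null_content_dominatesP => B mB PB.
  by apply/eqP; rewrite eq_le measure_ge0 andbT -PB nuE nu_le.
have [h [h0 hfin hint hE]] := radon_nikodym_sigma_finite dom.
have mh := measurable_int _ hint.
pose f y := Num.min (fine (h y)) 1%R.
have mfh : measurable_fun [set: R] (fine \o h).
  by apply/measurable_EFinP; apply: eq_measurable_fun mh => x _ /=; rewrite fineK.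
have mf : measurable_fun [set: R] f.
  by apply: measurable_minr.
have f01 : unit_valued f.
  by move=> y; rewrite /f ge_min lexx orbT le_min ler01 andbT fine_ge0.
exists f; split => // B mB.
have -> : \int[P]_(w in X @^-1` B) (f (X w))%:E =
    \int[distribution P X]_(y in B) (f y)%:E.
  rewrite [RHS]ge0_integral_pushforward//.
    by apply: measurable_funTS; exact/measurable_EFinP.
  by move=> y _; rewrite lee_fin; have /andP[] := f01 y.
rewrite -mE -nu0E -nuE.
(* Off [H] the derivative [h] is cut at 1 without changing its integral: the
   image measure is the integral of [h], at least that of 1, which is the law
   of [X], which in turn is at least the image measure. *)
pose H := [set y | (fine (h y) <= 1)%R].
have mH : measurable H.
  rewrite -[X in measurable X]setTI; exact: measurable_fun_le.
have BH : B = (B `&` H) `|` (B `&` ~` H) by rewrite -setIUr setUv setIT.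
have mBH : measurable (B `&` H) by exact: measurableI.
have mBNH : measurable (B `&` ~` H) by apply: measurableI => //; exact: measurableC.
have mEf : measurable_fun [set: R] (EFin \o f) by exact/measurable_EFinP.
have f0 y : 0 <= (f y)%:E by rewrite lee_fin; have /andP[] := f01 y.
have BH0 : (B `&` H) `&` (B `&` ~` H) = set0 by rewrite setIACA setICr setI0.
rewrite [in RHS]BH ge0_integral_setU//; last 2 first.
- by rewrite -BH; exact: measurable_funTS.
- exact/disj_set2P.
have -> : nu B = nu (B `&` H) + nu (B `&` ~` H) by rewrite -measureU// -BH.
congr (_ + _).
  rewrite hE//; apply: eq_integral => y; rewrite inE => -[_ Hy].
  by rewrite /f min_l// fineK.
apply/eqP; rewrite eq_le; apply/andP; split.
  rewrite nuE (le_trans (nu_le _ mBNH))//.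
  rewrite -[leLHS]mul1e -integral_cst//.
  apply: ge0_le_integral => //.
  - exact: measurable_funTS.
  - move=> y [_ /negP]; rewrite -ltNge => /ltW Hy.
    by rewrite /f min_r.
rewrite [leRHS]hE//; apply: ge0_le_integral => //.
- exact: measurable_funTS.
- exact: measurable_funTS.
- by move=> y _; rewrite -[leRHS]fineK// lee_fin /f ge_min lexx.
Qed.

End ConditionalExpectation.

(** * Past and future of a Markov chain *)

Section SigmaFields.
Context d {T : measurableType d} {R : realType} (P : probability T R).
Variable X : int -> {RV P >-> R}.
Implicit Types (I J : set int) (f g : T -> R).

Lemma sigma_of_preimage I i (B : set R) :
  I i -> measurable B -> sigma_of X I (X i @^-1` B).
Proof.
move=> Ii mB; apply: sub_sigma_algebra; exists i => //.
by exists B => //; rewrite setTI.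
Qed.

Lemma sigma_of_sub I (G : set (set T)) : sigma_algebra setT G ->
    (forall i B, I i -> measurable B -> G (X i @^-1` B)) ->
  sigma_of X I `<=` G.
Proof.
move=> sG H; apply: smallest_sub => // E [i Ii [B mB <-]].
by rewrite setTI; exact: H.
Qed.

Lemma sigma_of_measurable I E : sigma_of X I E -> measurable E.
Proof.
apply: (sigma_of_sub (@sigma_algebra_measurable _ T)) => i B _ mB.
exact: measurable_funPTI.
Qed.

Lemma sigma_ofS I J : I `<=` J -> sigma_of X I `<=` sigma_of X J.
Proof.
move=> IJ; apply: sigma_of_sub; first exact: smallest_sigma_algebra.
by move=> i B /IJ; exact: sigma_of_preimage.
Qed.

Lemma sigma_ofT I : sigma_of X I setT.
Proof. exact: (@measurableT _ (g_sigma_algebraType _)). Qed.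

Lemma sigma_ofI I E F : sigma_of X I E -> sigma_of X I F -> sigma_of X I (E `&` F).
Proof. exact: (@measurableI _ (g_sigma_algebraType _)). Qed.

Lemma sigma_ofC I E : sigma_of X I E -> sigma_of X I (~` E).
Proof. exact: (@measurableC _ (g_sigma_algebraType _)). Qed.

Lemma measurable_wrt_fun I f :
  measurable_wrt (sigma_of X I) f -> measurable_fun [set: T] f.
Proof. by move=> mf _ B mB; rewrite setTI; exact: sigma_of_measurable (mf _ mB). Qed.

Lemma measurable_wrtS I J f : I `<=` J ->
  measurable_wrt (sigma_of X I) f -> measurable_wrt (sigma_of X J) f.
Proof. by move=> IJ mf B mB; apply: sigma_ofS IJ _ _; exact: mf. Qed.

Lemma measurable_wrt_comp G (h : R -> R) f : measurable_fun [set: R] h ->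
  measurable_wrt G f -> measurable_wrt G (h \o f).
Proof.
move=> mh mf B mB; rewrite comp_preimage; apply: mf.
by rewrite -[Z in measurable Z]setTI; exact: mh.
Qed.

Lemma measurable_wrt_RV I i : I i -> measurable_wrt (sigma_of X I) (X i).
Proof. by move=> Ii B mB; exact: sigma_of_preimage. Qed.

End SigmaFields.

Section Markov.
Context d {T : measurableType d} {R : realType} (P : probability T R).
Variable X : int -> {RV P >-> R}.
Hypothesis HM : markov_chain X.
Local Open Scope ereal_scope.

Lemma integral_unit_valued_lty (F : T -> R) :
  measurable_fun [set: T] F -> unit_valued F -> \int[P]_w (F w)%:E < +oo.
Proof.
move=> mF F01; apply: (@le_lt_trans _ _ (\int[P]_w 1)).
  apply: ge0_le_integral => //.
  - by move=> w _; rewrite lee_fin; have /andP[] := F01 w.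
  - exact/measurable_EFinP.
  - by move=> w _; rewrite lee_fin; have /andP[] := F01 w.
by rewrite integral_cst// mul1e ltey_eq fin_num_measure.
Qed.

(** The Markov property holds for some version of the conditional probability;
    a version is nonnegative only almost surely, and its positive part is
    another version. *)
Lemma exists_transition (n : int) (B : set R) : measurable B ->
  exists g : T -> R, [/\ measurable_wrt (sigma_of X [set n]) g,
    forall w, (0 <= g w)%R &
    forall A, sigma_of X [set i | (i <= n)%R] A ->
      \int[P]_(w in A) (g w)%:E = P (A `&` X (n + 1)%R @^-1` B)].
Proof.
move=> mB; have [g [mg ig _] [_ _ gE]] := HM n mB.
have mgT := measurable_wrt_fun mg.
pose N := [set w | (g w < 0)%R].
have sN : sigma_of X [set i | (i <= n)%R] N.
  have NE : N = g @^-1` `]-oo, 0%R[.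
    by apply/seteqP; split=> w; rewrite /N/= in_itv.
  have nS : [set n] `<=` [set i | (i <= n)%R] by move=> i -> /=.
  by apply: (sigma_ofS nS); rewrite NE; exact: mg.
exists (fun w => Num.max (g w) 0%R); split.
- apply: (@measurable_wrt_comp _ _ _ _ (fun t => Num.max t 0%R)) => //.
  exact: measurable_maxr.
- by move=> w; rewrite le_max lexx orbT.
move=> A sA.
have mA := sigma_of_measurable sA; have mN := sigma_of_measurable sN.
have sAN := sigma_ofI sA sN; have sANC := sigma_ofI sA (sigma_ofC sN).
have mAN := sigma_of_measurable sAN; have mANC := sigma_of_measurable sANC.
have AN : A = (A `&` N) `|` (A `&` ~` N) by rewrite -setIUr setUv setIT.
have AN0 : (A `&` N) `&` (A `&` ~` N) = set0 by rewrite setIACA setICr setI0.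
have mH := measurable_funPTI (X (n + 1)%R) mB.
have PAN : P ((A `&` N) `&` X (n + 1)%R @^-1` B) = 0.
  apply/eqP; rewrite eq_le measure_ge0 andbT -gE//.
  have -> : \int[P]_(w in A `&` N) (g w)%:E =
      - \int[P]_(w in A `&` N) (- g w)%:E.
    rewrite -integral_ge0N; last by move=> w [_ gw]; rewrite lee_fin oppr_ge0 ltW.
    by apply: eq_integral => w _; rewrite EFinN oppeK.
  rewrite oppe_le0; apply: integral_ge0 => w [_ gw].
  by rewrite lee_fin oppr_ge0 ltW.
have mgm : measurable_fun [set: T] (fun w => (Num.max (g w) 0%R)%:E).
  by apply/measurable_EFinP; apply: measurable_maxr => //; exact: measurable_cst.
rewrite [in LHS]AN ge0_integral_setU//; last 3 first.
- exact: measurable_funTS.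
- by move=> w _; rewrite lee_fin le_max lexx orbT.
- exact/disj_set2P.
rewrite integral0_eq ?add0e; last by move=> w [_ gw]; rewrite max_r// ltW.
have -> : \int[P]_(w in A `&` ~` N) (Num.max (g w) 0%R)%:E =
    \int[P]_(w in A `&` ~` N) (g w)%:E.
  apply: eq_integral => w; rewrite inE => -[_ /negP]; rewrite -leNgt => gw.
  by rewrite max_l.
have -> : P (A `&` X (n + 1)%R @^-1` B) =
    P (A `&` N `&` X (n + 1)%R @^-1` B) + P (A `&` ~` N `&` X (n + 1)%R @^-1` B).
  rewrite -measureU//; first by rewrite -setIUl -AN.
  - exact: measurableI.
  - exact: measurableI.
  - by rewrite setIACA AN0 set0I.
rewrite gE//.
by rewrite PAN add0e.
Qed.

(** Integrating a function of the past over an event of time [n + 1] amounts to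
    integrating it against the transition probability [g]: the measures
    [P (_ `&` X (n + 1) @^-1` B)] and [g P] agree on the past of [n]. *)
Lemma integral_transition (n : int) (B : set R) (g : T -> R) :
    measurable B -> measurable_wrt (sigma_of X [set n]) g ->
    (forall w, (0 <= g w)%R) ->
    (forall A, sigma_of X [set i | (i <= n)%R] A ->
      \int[P]_(w in A) (g w)%:E = P (A `&` X (n + 1)%R @^-1` B)) ->
  forall (A : set T) (phi : T -> R),
    sigma_of X [set i | (i <= n)%R] A ->
    measurable_wrt (sigma_of X [set i | (i <= n)%R]) phi ->
    (forall w, (0 <= phi w)%R) ->
  \int[P]_(w in A `&` X (n + 1)%R @^-1` B) (phi w)%:E =
  \int[P]_(w in A) ((g w)%:E * (phi w)%:E).
Proof.
move=> mB mg g0 gE A phi sA mphi phi0.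
have mgT := measurable_wrt_fun mg; have mphiT := measurable_wrt_fun mphi.
have mA := sigma_of_measurable sA.
have mH := measurable_funPTI (X (n + 1)%R) mB.
have [m mE] := exists_density P mgT g0.
have mEphi : measurable_fun [set: T] (EFin \o phi) by exact/measurable_EFinP.
transitivity (\int[mrestr P mH]_(w in A) (phi w)%:E).
  rewrite [in RHS]integral_mkcond ge0_integral_mrestr//.
  - rewrite setIC integral_mkcondr; apply: eq_integral => w _.
    by rewrite /patch; case: ifPn.
  - by apply/(measurable_restrictT _ _).1 => //; exact: measurable_funTS.
  - by apply: erestrict_ge0 => w _; rewrite lee_fin.
transitivity (\int[m]_(w in A) (phi w)%:E).
  apply: ge0_eq_integral_preimage => // D mD.
  rewrite mE gE//; apply: sigma_ofI => //; exact: mphi.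
rewrite (@ge0_integral_density_in _ _ _ P m g)//.
by apply: eq_integral => w _; rewrite muleC.
Qed.

Let window (k : int) (l : nat) : set int := [set i | (k <= i <= k + l%:Z)%R].

(** Extension of the Markov property to a finite window of the future, one date
    at a time. Write [m1] and [m2] for the measures of densities [F] and
    [f \o X k]. The last date of the window enters an event through some
    [X (n + 1) @^-1` B], and [integral_transition] trades it, under both
    measures, for the same function [g] of [X n], on which the measures agree
    by induction. *)
Lemma markov_window (k : int) (F : T -> R) (f : R -> R) :
    measurable_wrt (sigma_of X [set i | (i <= k)%R]) F -> unit_valued F ->
    measurable_fun [set: R] f -> unit_valued f ->
    conditional_mean (X k) F f ->
  forall l E, sigma_of X (window k l) E ->
  \int[P]_(w in E) (F w)%:E = \int[P]_(w in E) (f (X k w))%:E.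
Proof.
move=> mF F01 mf f01 FfE.
have F0 w : (0 <= F w)%R by have /andP[] := F01 w.
have mFT := measurable_wrt_fun mF.
have mfX : measurable_wrt (sigma_of X [set k]) (f \o X k).
  by apply: measurable_wrt_comp => //; exact: measurable_wrt_RV.
have f0 w : (0 <= (f \o X k) w)%R by have /andP[] := f01 (X k w).
have mfXT := measurable_wrt_fun mfX.
have [m1 m1E] := exists_density P mFT F0.
have [m2 m2E] := exists_density P mfXT f0.
have m1oo : m1 setT < +oo by rewrite m1E; exact: integral_unit_valued_lty.
suff H l E : sigma_of X (window k l) E -> m1 E = m2 E.
  by move=> l E /H; rewrite m1E m2E.
elim: l E => [|l IHl] E.
  apply: eq_measure_g_sigma_algebra => //.
  - move=> _ [i _ [B mB <-]]; rewrite setTI; exact: measurable_funPTI.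
  - move=> _ _ [i ki [B mB <-]] [j kj [C mC <-]].
    have {ki}-> : i = k by move: ki; rewrite /window/=; lia.
    have {kj}-> : j = k by move: kj; rewrite /window/=; lia.
    exists k; first by rewrite /window/=; lia.
    by exists (B `&` C); [exact: measurableI|rewrite !setTI preimage_setI].
  - exists k; first by rewrite /window/=; lia.
    by exists setT => //; rewrite setTI preimage_setT.
  - move=> _ [i ki [B mB <-]]; rewrite setTI m1E m2E.
    have {ki}-> : i = k by move: ki; rewrite /window/=; lia.
    exact: FfE.
pose n := (k + l%:Z)%R.
have kn : (k <= n)%R by rewrite /n; lia.
have wn : window k l `<=` [set i | (i <= n)%R] by move=> i /andP[].
pose G := [set A | exists2 E', sigma_of X (window k l) E' &
  exists2 B : set R, measurable B & A = E' `&` X (n + 1)%R @^-1` B].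
have GE : sigma_of X (window k l.+1) `<=` <<s G >>.
  apply: sigma_of_sub; first exact: smallest_sigma_algebra.
  move=> i B; rewrite /window/= => ki mB; apply: sub_sigma_algebra.
  have [->|ni] := eqVneq i (n + 1)%R.
    by exists setT; [exact: sigma_ofT|exists B => //; rewrite setTI].
  exists (X i @^-1` B).
    apply: sigma_of_preimage => //; rewrite /window/=; move: ni ki; rewrite /n; lia.
  by exists setT => //; rewrite preimage_setT setIT.
move=> /GE; apply: eq_measure_g_sigma_algebra => //.
- move=> _ [E' sE' [B mB ->]]; apply: measurableI; last exact: measurable_funPTI.
  exact: sigma_of_measurable sE'.
- move=> _ _ [E1 sE1 [B1 mB1 ->]] [E2 sE2 [B2 mB2 ->]].
  exists (E1 `&` E2); first exact: sigma_ofI.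
  by exists (B1 `&` B2); [exact: measurableI|rewrite preimage_setI setIACA].
- exists setT; first exact: sigma_ofT.
  by exists setT => //; rewrite preimage_setT setIT.
move=> _ [E' sE' [B mB ->]].
have [g [mg g0 gE]] := exists_transition n mB.
have mgT := measurable_wrt_fun mg.
have mE' := sigma_of_measurable sE'.
have sE'n : sigma_of X [set i | (i <= n)%R] E' by exact: sigma_ofS sE'.
have gEphi := integral_transition mB mg g0 gE sE'n.
rewrite m1E m2E !gEphi//; last 2 first.
- by apply: measurable_wrtS mfX => i -> /=.
- by apply: measurable_wrtS mF => i /le_trans; apply.
rewrite -(@ge0_integral_density_in _ _ _ P m1 F)//; last exact/measurable_EFinP.
rewrite -(@ge0_integral_density_in _ _ _ P m2 (f \o X k))//; last first.
  exact/measurable_EFinP.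
apply: ge0_eq_integral_preimage => // D mD; apply: IHl; apply: sigma_ofI => //.
apply: sigma_ofS (mg D mD) => i -> /=; rewrite /window/= /n; lia.
Qed.

(** Given the present [X k], the past enters a computation about the future
    only through its regression on [X k]. *)
Lemma markov_future (k : int) (F : T -> R) (f : R -> R) :
    measurable_wrt (sigma_of X [set i | (i <= k)%R]) F -> unit_valued F ->
    measurable_fun [set: R] f -> unit_valued f ->
    conditional_mean (X k) F f ->
  forall phi, measurable_wrt (sigma_of X [set i | (k <= i)%R]) phi ->
    (forall w, (0 <= phi w)%R) ->
  \int[P]_w (F w * phi w)%:E = \int[P]_w (f (X k w) * phi w)%:E.
Proof.
move=> mF F01 mf f01 FfE phi mphi phi0.
have F0 w : (0 <= F w)%R by have /andP[] := F01 w.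
have mFT := measurable_wrt_fun mF.
have f0 w : (0 <= (f \o X k) w)%R by have /andP[] := f01 (X k w).
have mfXT : measurable_fun [set: T] (f \o X k) by exact: measurableT_comp.
have mphiT := measurable_wrt_fun mphi.
have [m1 m1E] := exists_density P mFT F0.
have [m2 m2E] := exists_density P mfXT f0.
have m1oo : m1 setT < +oo by rewrite m1E; exact: integral_unit_valued_lty.
suff H E : sigma_of X [set i | (k <= i)%R] E -> m1 E = m2 E.
  under eq_integral do rewrite mulrC EFinM.
  under [RHS]eq_integral do rewrite mulrC EFinM.
  rewrite -(@ge0_integral_density _ _ _ P m1 F)//; last exact/measurable_EFinP.
  rewrite -(@ge0_integral_density _ _ _ P m2 (f \o X k))//; last exact/measurable_EFinP.
  by apply: ge0_eq_integral_preimage => // D mD; rewrite setIT; apply: H; exact: mphi.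
(* the windows increase, so the events that they determine form a pi-system *)
pose G := \bigcup_l sigma_of X (window k l).
have GE : sigma_of X [set i | (k <= i)%R] `<=` <<s G >>.
  apply: sigma_of_sub; first exact: smallest_sigma_algebra.
  move=> i B /= ki mB; apply: sub_sigma_algebra; exists `|i - k|%N => //.
  apply: sigma_of_preimage => //; rewrite /window/=; lia.
move=> /GE; apply: eq_measure_g_sigma_algebra => //.
- move=> E' [l _]; exact: sigma_of_measurable.
- move=> A B [l1 _ sA] [l2 _ sB]; exists (maxn l1 l2) => //.
  apply: sigma_ofI.
  + by apply: sigma_ofS sA => i; rewrite /window/=; lia.
  + by apply: sigma_ofS sB => i; rewrite /window/=; lia.
- by exists 0%N => //; exact: sigma_ofT.
move=> A [l _ sA]; rewrite m1E m2E; exact: markov_window sA.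
Qed.

End Markov.

(** * The measure of a copula *)

Section LawOfPair.
Context {R : realType}.
Local Open Scope ereal_scope.

Lemma measurable_unit_itv : measurable (@unit_itv R).
Proof. exact: measurable_itv. Qed.

Lemma measurable_unit_square : measurable (@unit_square R).
Proof. by apply: measurableX; exact: measurable_unit_itv. Qed.

Lemma measurable_sub_rays (S : set (set R)) : sigma_algebra setT S ->
  (forall x, S `]-oo, x]%classic) -> measurable `<=` S.
Proof.
move=> [S0 SC SU] Sray.
suff : (@RGenOInfty.G R).-sigma.-measurable `<=` S.
  by rewrite -RGenOInfty.measurableE.
apply: smallest_sub => // _ [x ->].
by rewrite -setCitvl -setTD; apply: SC.
Qed.

(* The whole line is counted as a ray, so that products of such sets form a
   pi-system that contains the whole plane. *)
Let corner := [set A : set R | A = setT \/ exists x, A = `]-oo, x]%classic].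

(** A copula only fixes the values of the distribution function on the square.
    This determines a measure that gives no mass to the complement of the
    square, because the trace on the square of a corner, bounded or not, is
    either empty or that of a corner with vertex in the square. *)
Lemma eq_measure_corners (m1 m2 : {measure set (R * R)%type -> \bar R}) :
    m1 setT < +oo ->
    m1 (~` unit_square) = 0 -> m2 (~` unit_square) = 0 ->
    (forall x y, unit_itv x -> unit_itv y ->
      m1 (`]-oo, x] `*` `]-oo, y]) = m2 (`]-oo, x] `*` `]-oo, y])) ->
  forall A, measurable A -> m1 A = m2 A.
Proof.
move=> m1oo m10 m20 m12.
pose G := [set A `*` B | A in corner & B in corner].
have mcorner A : corner A -> measurable A.
  by move=> [->//|[x ->]]; exact: measurable_itv.
have cornerI : setI_closed corner.
  move=> A B [->|[x ->]]; first by rewrite setTI.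
  move=> [->|[y ->]]; first by rewrite setIT; right; exists x.
  right; exists (Num.min x y); apply/seteqP; split => z; rewrite /= !in_itv/=.
    by move=> [zx zy]; rewrite le_min zx.
  by rewrite le_min => /andP[].
have GE : measurable `<=` <<s G >>.
  have sG := @smallest_sigma_algebra _ setT G.
  have fstE : measurable `<=` image_set_system setT fst <<s G >>.
    apply: measurable_sub_rays; first exact: sigma_algebra_image.
    move=> x; rewrite /image_set_system/= setTI; apply: sub_sigma_algebra.
    exists `]-oo, x]%classic; first by right; exists x.
    exists setT; first by left.
    by apply/seteqP; split => -[a b] //= [].
  have sndE : measurable `<=` image_set_system setT snd <<s G >>.
    apply: measurable_sub_rays; first exact: sigma_algebra_image.
    move=> x; rewrite /image_set_system/= setTI; apply: sub_sigma_algebra.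
    exists setT; first by left.
    exists `]-oo, x]%classic; first by right; exists x.
    by apply/seteqP; split => -[a b] //= [].
  rewrite measurable_prod_measurableType; apply: smallest_sub => //.
  move=> _ [A mA] [B mB] <-.
  have -> : A `*` B = fst @^-1` A `&` snd @^-1` B by [].
  apply: (@measurableI _ (g_sigma_algebraType G)).
    by have := fstE A mA; rewrite /image_set_system/= setTI.
  by have := sndE B mB; rewrite /image_set_system/= setTI.
move=> A /GE; apply: eq_measure_g_sigma_algebra => //.
- by move=> _ [B cB] [D cD] <-; apply: measurableX; exact: mcorner.
- move=> _ _ [B1 cB1] [D1 cD1 <-] [B2 cB2] [D2 cD2 <-].
  exists (B1 `&` B2); first exact: cornerI.
  by exists (D1 `&` D2); [exact: cornerI|rewrite setXI].
- by exists setT; [left|exists setT; [left|rewrite setXTT]].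
move=> _ [B cB] [D cD] <-.
have square (m : {measure set (R * R)%type -> \bar R}) E :
    m (~` unit_square) = 0 -> measurable E -> m E = m (E `&` unit_square).
  move=> m0 mE; rewrite (measureDI m mE measurable_unit_square).
  rewrite (@subset_measure0 _ _ _ m _ (~` unit_square)) ?add0e//.
  - exact: measurableD measurable_unit_square.
  - exact: measurableC measurable_unit_square.
have cornerE (E : set R) : corner E ->
    E `&` unit_itv = set0 \/
    exists2 x, unit_itv x & E `&` unit_itv = `]-oo, x] `&` unit_itv.
  move=> [->|[x ->]].
    right; exists 1%R; first by rewrite /unit_itv/= in_itv/= ler01 lexx.
    apply/seteqP; split => z /=; rewrite /unit_itv/= !in_itv/=.
      by move=> [_ /andP[-> ->]].
    by move=> [_ ->].
  have [x0|x0] := ltP x 0%R.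
    left; apply/seteqP; split => z //=.
    rewrite /unit_itv/= !in_itv/= => -[zx /andP[z0 _]].
    by have := le_lt_trans (le_trans z0 zx) x0; rewrite ltxx.
  right; exists (Num.min x 1%R).
    by rewrite /unit_itv/= in_itv/= le_min x0 ler01 ge_min lexx orbT.
  apply/seteqP; split => z /=; rewrite /unit_itv/= !in_itv/= le_min.
    by move=> [-> /andP[-> ->]].
  by move=> [/andP[-> _] ->].
have mBD : measurable (B `*` D) by apply: measurableX; exact: mcorner.
rewrite (square m1)// (square m2)// /unit_square -setXI.
case: (cornerE _ cB) => [->|[x Ix ->]]; first by rewrite set0X !measure0.
case: (cornerE _ cD) => [->|[y Iy ->]]; first by rewrite setX0 !measure0.
have mxy : measurable (`]-oo, x]%classic `*` `]-oo, y]%classic) by exact: measurableX.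
by rewrite setXI -(square m1)// -(square m2)// m12.
Qed.

End LawOfPair.

Section PairIntegral.
Context {R : realType}.
Local Notation L := (measurableTypeR R).
Local Open Scope ereal_scope.

Lemma uniform01_unit_itv d (T : measurableType d) (P : probability T R)
  (U : {RV P >-> R}) : uniform01 U -> P (U @^-1` (~` unit_itv)) = 0.
Proof.
move=> uU; have mI : measurable (U @^-1` unit_itv).
  exact: measurable_funPTI measurable_unit_itv.
rewrite preimage_setC probability_setC//.
have -> : P (U @^-1` unit_itv) = uniform_prob (@ltr01 R) unit_itv.
  by rewrite -(uU _ measurable_unit_itv).
by rewrite /uniform_prob integral_uniform_pdf1// subee.
Qed.

Lemma uniform01_integral d (T : measurableType d) (P : probability T R)
    (U : {RV P >-> R}) (f : R -> \bar R) : uniform01 U ->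
    measurable_fun [set: R] f -> (forall x, 0 <= f x) ->
  \int[P]_w f (U w) = \int[lebesgue_measure]_(x in unit_itv) f x.
Proof.
move=> uU mf f0.
have mU : measurable_fun [set: T] (U : T -> L) by exact: (measurable_funPT U).
pose U' : {mfun T >-> L} := @mfun_Sub _ _ T L U (mem_set mU).
have mf' : measurable_fun [set: L] f by exact: mf.
transitivity (\int[uniform_prob (@ltr01 R)]_x f x).
  rewrite -[LHS](@ge0_integral_distribution _ _ _ _ _ P U' f mf' f0).
  by apply: eq_measure_integral => A mA _; exact: uU.
by rewrite integral_uniform// subr0 invr1 mul1e.
Qed.

Lemma joint_law_integral d (T : measurableType d) (P : probability T R)
    (U V : {RV P >-> R}) (C : R -> R -> R) (mu : probability (R * R)%type R)
    (psi : R * R -> \bar R) :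
    uniform01 U -> uniform01 V -> joint_cdf U V C -> copula_measure C mu ->
    measurable_fun [set: R * R] psi -> (forall z, 0 <= psi z) ->
  \int[P]_w psi (U w, V w) = \int[mu]_z psi z.
Proof.
move=> uU uV UVC [mu1 muC] mpsi psi0.
have mW : measurable_fun [set: T] (fun w => (U w, V w)).
  by apply: measurable_fun_pair; exact: measurable_funPT.
pose W : {mfun T >-> (R * R)%type} := mfun_Sub (mem_set mW).
have W0 : P (W @^-1` (~` unit_square)) = 0.
  have -> : W @^-1` (~` unit_square) =
      U @^-1` (~` unit_itv) `|` V @^-1` (~` unit_itv).
    apply/seteqP; split => w /=; first by move=> /not_andP.
    by move=> h; apply/not_andP.
  transitivity (P (U @^-1` (~` unit_itv))); last exact: uniform01_unit_itv.
  apply: measureU0; last exact: uniform01_unit_itv.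
  - by apply: measurable_funPTI; exact: measurableC measurable_unit_itv.
  - by apply: measurable_funPTI; exact: measurableC measurable_unit_itv.
have mu0 : mu (~` unit_square) = 0.
  by rewrite probability_setC ?mu1 ?subee//; exact: measurable_unit_square.
rewrite -[LHS](@ge0_integral_distribution _ _ _ _ _ P W)//.
apply: (@eq_measure_integral _ _ _ setT mu (distribution P W)) => A mA _.
apply: (@eq_measure_corners _ (distribution P W) mu) => //.
- by rewrite ltey_eq fin_num_measure.
- move=> x y Ix Iy; apply: (eq_trans _ (muC x y Ix Iy)).
  rewrite (UVC _ _ Ix Iy).
  by congr (P _); apply/seteqP; split => w /=; rewrite !in_itv.
Qed.

(** Tonelli's theorem, integrating the variable that does not occur in the
    weight first: lower bounds of [psi] on average along the lines suffice. *)
Lemma ge0_integral_separated (a b : L -> R) (psi : L * L -> R) (va vb : \bar R) :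
    measurable_fun [set: L] a -> (forall x, (0 <= a x)%R) ->
    measurable_fun [set: L] b -> (forall x, (0 <= b x)%R) ->
    measurable_fun [set: L * L] psi -> (forall z, (0 <= psi z)%R) ->
    0 <= va -> 0 <= vb ->
    (forall x, va <= \int[lebesgue_measure]_(y in unit_itv) (psi (x, y))%:E) ->
    (forall y, vb <= \int[lebesgue_measure]_(x in unit_itv) (psi (x, y))%:E) ->
  va * \int[lebesgue_measure]_x (a x)%:E + vb * \int[lebesgue_measure]_y (b y)%:E
    <= \int[@lebesgue2 R]_z
      (psi z * (a z.1 * \1_unit_itv z.2 + \1_unit_itv z.1 * b z.2))%:E.
Proof.
move=> ma a0 mb b0 mpsi psi0 va0 vb0 vaE vbE.
have m1 : measurable_fun [set: L] (\1_unit_itv : L -> R).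
  by apply: measurable_indic; exact: measurable_unit_itv.
have ma1 : measurable_fun [set: L * L] (a \o fst) by exact: measurableT_comp.
have mb2 : measurable_fun [set: L * L] (b \o snd) by exact: measurableT_comp.
have m11 : measurable_fun [set: L * L] ((\1_unit_itv : L -> R) \o fst).
  exact: measurableT_comp.
have m12 : measurable_fun [set: L * L] ((\1_unit_itv : L -> R) \o snd).
  exact: measurableT_comp.
pose h1 z := (psi z * (a z.1 * \1_unit_itv z.2))%R.
pose h2 z := (psi z * (\1_unit_itv z.1 * b z.2))%R.
have mh1 : measurable_fun [set: L * L] (EFin \o h1).
  by apply/measurable_EFinP; apply: measurable_funM => //; exact: measurable_funM.
have mh2 : measurable_fun [set: L * L] (EFin \o h2).
  by apply/measurable_EFinP; apply: measurable_funM => //; exact: measurable_funM.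
have h10 z : 0 <= (EFin \o h1) z by rewrite lee_fin !mulr_ge0.
have h20 z : 0 <= (EFin \o h2) z by rewrite lee_fin !mulr_ge0.
have -> : \int[@lebesgue2 R]_z
      (psi z * (a z.1 * \1_unit_itv z.2 + \1_unit_itv z.1 * b z.2))%:E =
    \int[@lebesgue2 R]_z (EFin \o h1) z + \int[@lebesgue2 R]_z (EFin \o h2) z.
  rewrite -ge0_integralD//.
  by apply: eq_integral => z _; rewrite mulrDr EFinD.
have mpsix x : measurable_fun [set: L] (fun y => (psi (x, y))%:E).
  by apply/measurable_EFinP; exact: measurableT_comp.
have mpsiy y : measurable_fun [set: L] (fun x => (psi (x, y))%:E).
  by apply/measurable_EFinP; apply: (measurableT_comp mpsi); exact: measurable_pair2.
apply: leeD.
- rewrite /lebesgue2 (fubini_tonelli1 _ mh1 h10) -ge0_integralZl//; last 2 first.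
    exact/measurable_EFinP.
    by move=> x _; rewrite lee_fin.
  apply: ge0_le_integral => //.
  + by move=> x _; rewrite mule_ge0// lee_fin.
  + by apply: emeasurable_funM => //; exact/measurable_EFinP.
  + exact: (measurable_fun_fubini_tonelli_F _ mh1 h10).
  move=> x _; rewrite /fubini_F.
  have -> : \int[lebesgue_measure]_y (EFin \o h1) (x, y) =
      (a x)%:E * \int[lebesgue_measure]_(y in unit_itv) (psi (x, y))%:E.
    rewrite [X in _ * X]integral_mkcond -ge0_integralZl//; last 3 first.
    - apply/(measurable_restrictT _ _).1; first exact: measurable_unit_itv.
      exact: measurable_funTS.
    - by move=> y _; apply: erestrict_ge0 => ? _; rewrite lee_fin.
    - by rewrite lee_fin.
    apply: eq_integral => y _; rewrite epatch_indic /h1/= -!EFinM; congr EFin; ring.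
  by rewrite muleC lee_wpmul2l ?lee_fin.
- rewrite /lebesgue2 (fubini_tonelli2 _ mh2 h20) -ge0_integralZl//; last 2 first.
    exact/measurable_EFinP.
    by move=> x _; rewrite lee_fin.
  apply: ge0_le_integral => //.
  + by move=> x _; rewrite mule_ge0// lee_fin.
  + by apply: emeasurable_funM => //; exact/measurable_EFinP.
  + exact: (measurable_fun_fubini_tonelli_G _ mh2 h20).
  move=> y _; rewrite /fubini_G.
  have -> : \int[lebesgue_measure]_x (EFin \o h2) (x, y) =
      (b y)%:E * \int[lebesgue_measure]_(x in unit_itv) (psi (x, y))%:E.
    rewrite [X in _ * X]integral_mkcond -ge0_integralZl//; last 3 first.
    - apply/(measurable_restrictT _ _).1; first exact: measurable_unit_itv.
      exact: measurable_funTS.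
    - by move=> x _; apply: erestrict_ge0 => ? _; rewrite lee_fin.
    - by rewrite lee_fin.
    apply: eq_integral => x _; rewrite epatch_indic /h2/= -!EFinM; congr EFin; ring.
  by rewrite muleC lee_wpmul2l ?lee_fin.
Qed.

(** The measure of the copula dominates its absolutely continuous part, whose
    density dominates the separated weight. *)
Lemma ac_density_integral_ge (C : R -> R -> R) (c : R * R -> R)
    (eps1 eps2 : R -> R) (psi : R * R -> R) (v1 v2 : \bar R) :
    ac_density C c ->
    (forall x, unit_itv x -> (0 <= eps1 x)%R) ->
    (forall x, unit_itv x -> (0 <= eps2 x)%R) ->
    measurable_fun (unit_itv : set L) eps1 -> measurable_fun (unit_itv : set L) eps2 ->
    {ae @lebesgue2 R, forall z, unit_square z -> (eps1 z.1 + eps2 z.2 <= c z)%R} ->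
    measurable_fun [set: R * R] psi -> (forall z, (0 <= psi z)%R) ->
    0 <= v1 -> 0 <= v2 ->
    (forall x, v1 <= \int[lebesgue_measure]_(y in unit_itv) (psi (x, y))%:E) ->
    (forall y, v2 <= \int[lebesgue_measure]_(x in unit_itv) (psi (x, y))%:E) ->
  exists2 mu : probability (R * R)%type R, copula_measure C mu &
  v1 * \int[lebesgue_measure]_(x in unit_itv) (eps1 x)%:E +
  v2 * \int[lebesgue_measure]_(y in unit_itv) (eps2 y)%:E <= \int[mu]_z (psi z)%:E.
Proof.
move=> [mu [mua [mus [muC muE _ _ [mc c0 muaE]]]]].
move=> e10 e20 me1 me2 c_ge mpsi psi0 v10 v20 v1E v2E.
exists mu => //.
have mI := @measurable_unit_itv R; have mS := @measurable_unit_square R.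
pose a := eps1 \_ unit_itv; pose b := eps2 \_ unit_itv; pose c' := c \_ unit_square.
have mIL : measurable (unit_itv : set L) by exact: mI.
have ma : measurable_fun [set: L] a by exact: (measurable_restrictT eps1 mIL).1.
have mb : measurable_fun [set: L] b by exact: (measurable_restrictT eps2 mIL).1.
have mc' : measurable_fun [set: L * L] c'.
  by have : measurable_fun [set: R * R] c' by exact: (measurable_restrictT c mS).1.
have a0 x : (0 <= a x)%R by rewrite /a patchE; case: ifPn => // /set_mem; exact: e10.
have b0 x : (0 <= b x)%R by rewrite /b patchE; case: ifPn => // /set_mem; exact: e20.
have c'0 z : (0 <= c' z)%R by rewrite /c' patchE; case: ifPn => // /set_mem; exact: c0.
have aE : \int[lebesgue_measure]_(x in unit_itv) (eps1 x)%:E =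
    \int[lebesgue_measure]_x (a x)%:E.
  rewrite integral_mkcond; apply: eq_integral => x _.
  by rewrite /a !patchE; case: ifPn.
have bE : \int[lebesgue_measure]_(x in unit_itv) (eps2 x)%:E =
    \int[lebesgue_measure]_x (b x)%:E.
  rewrite integral_mkcond; apply: eq_integral => x _.
  by rewrite /b !patchE; case: ifPn.
rewrite aE bE.
have mEpsi : measurable_fun [set: R * R] (EFin \o psi) by exact/measurable_EFinP.
have mua_mu : \int[mua]_z (psi z)%:E <= \int[mu]_z (psi z)%:E.
  have <- : \int[measure_add mua mus]_z (psi z)%:E = \int[mu]_z (psi z)%:E.
    apply: eq_measure_integral => A mA _.
    by apply: (eq_trans (measure_addE mua mus A)); exact/esym/muE.
  rewrite ge0_integral_measure_add//; last by move=> z _; rewrite lee_fin.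
  by rewrite leeDl// integral_ge0// => z _; rewrite lee_fin.
(* Lebesgue measure is defined on a copy of the plane with the same Borel sets,
   to which the identity carries [mua]. *)
have mid : measurable_fun [set: R * R] (idfun : R * R -> L * L) by exact: measurable_id.
pose to_L : {mfun (R * R)%type >-> (L * L)%type} :=
  @mfun_Sub _ _ (R * R)%type (L * L)%type idfun (mem_set mid).
have muaE' (A : set (L * L)) : measurable A ->
    pushforward mua to_L A = \int[@lebesgue2 R]_(z in A) (c' z)%:E.
  move=> mA; rewrite -[LHS]/(mua A) muaE// integral_mkcondr; apply: eq_integral => z _.
  by rewrite /c' !patchE; case: ifPn.
have mpsiL : measurable_fun [set: L * L] psi by exact: mpsi.
have mEpsiL : measurable_fun [set: L * L] (EFin \o psi) by exact/measurable_EFinP.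
have Epsi0 z : 0 <= (EFin \o psi) z by rewrite lee_fin.
apply: (le_trans (ge0_integral_separated ma a0 mb b0 mpsiL psi0 v10 v20 v1E v2E)).
apply: le_trans mua_mu.
have -> : \int[mua]_z (psi z)%:E = \int[pushforward mua to_L]_z (psi z)%:E.
  by rewrite [RHS]ge0_integral_pushforward// => z _; exact: Epsi0.
rewrite (ge0_integral_density mc' c'0 muaE' mEpsiL Epsi0).
apply: ae_ge0_le_integral => //.
- move=> z _; rewrite lee_fin mulr_ge0// addr_ge0// mulr_ge0//.
- apply/measurable_EFinP; apply: measurable_funM => //.
  apply: measurable_funD; apply: measurable_funM.
  + exact: measurableT_comp.
  + by apply: measurableT_comp => //; exact: measurable_indic.
  + by apply: measurableT_comp => //; exact: measurable_indic.
  + exact: measurableT_comp.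
- by move=> z _; rewrite mule_ge0 ?lee_fin.
- by apply: emeasurable_funM => //; exact/measurable_EFinP.
- move: c_ge => [N [mN N0 sN]]; exists N; split => // -[x y] nz; apply: sN => c_ge.
  apply: nz => _; rewrite -EFinM lee_fin ler_wpM2l//=.
  move: c_ge; rewrite /a /b /c' !patchE !indicE/= in_setX/=.
  case: (boolP (x \in unit_itv)) => Ix; case: (boolP (y \in unit_itv)) => Iy /=;
    rewrite ?mulr0 ?mul0r ?addr0 ?mulr1 ?mul1r//.
  by apply; split; exact: set_mem.
exact: mid.
Qed.

End PairIntegral.

(** * Covariances of square integrable functions *)

Section Covariances.
Context d {T : measurableType d} {R : realType} (P : probability T R).
Implicit Types F G : T -> R.

Lemma Lfun_bounded (F : T -> R) (M : R) :
  measurable_fun [set: T] F -> (forall w, `|F w| <= M) -> F \in Lfun P 2%:E.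
Proof.
move=> mF FM; rewrite inE; apply/andP; split; rewrite inE//=.
rewrite /finite_norm unlock poweR_lty//.
apply: (@le_lt_trans _ _ (\int[P]_w (M `^ 2)%:E)%E).
  apply: ge0_le_integral => //=.
  - apply/measurable_EFinP; apply: (measurableT_comp (measurable_powR 2)) => //.
    exact: measurableT_comp.
  - by move=> w _; rewrite lee_fin ge0_ler_powR// nnegrE (le_trans _ (FM w)).
by rewrite integral_cst// ltey_eq fin_numM// fin_num_measure.
Qed.

Lemma unit_valued_Lfun F :
  measurable_fun [set: T] F -> unit_valued F -> F \in Lfun P 2%:E.
Proof.
move=> mF F01; apply: (@Lfun_bounded F 1) => // w.
by have /andP[F0 F1] := F01 w; rewrite ger0_norm.
Qed.

Lemma Lfun2_Lfun1 F : F \in Lfun P 2%:E -> F \in Lfun P 1.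
Proof. by apply: Lfun_subset12; exact: fin_num_measure. Qed.

Definition rcov F G := fine (covariance P F G).
Definition rvar F := rcov F F.

Lemma rvar_ge0 F : 0 <= rvar F.
Proof. by apply: fine_ge0; exact: variance_ge0. Qed.

Lemma covariance_rcov F G : F \in Lfun P 2%:E -> G \in Lfun P 2%:E ->
  covariance P F G = (rcov F G)%:E.
Proof.
move=> F2 G2; rewrite /rcov fineK//.
by apply: covariance_fin_num; [exact: Lfun2_Lfun1..|exact: Lfun2_mul_Lfun1].
Qed.

Lemma rvarB F G : F \in Lfun P 2%:E -> G \in Lfun P 2%:E ->
  variance P (F \- G) = (rvar F + rvar G - 2 * rcov F G)%:E.
Proof.
by move=> F2 G2; rewrite varianceB// /variance !covariance_rcov.
Qed.

(** The variance of [F - G] is nonnegative. *)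
Lemma rcov_double_le F G : F \in Lfun P 2%:E -> G \in Lfun P 2%:E ->
  2 * rcov F G <= rvar F + rvar G.
Proof.
move=> F2 G2; rewrite -subr_ge0 -lee_fin -rvarB//; exact: variance_ge0.
Qed.

Lemma rcov_le_sqrt F G : F \in Lfun P 2%:E -> G \in Lfun P 2%:E ->
  rcov F G <= Num.sqrt (rvar F) * Num.sqrt (rvar G).
Proof.
move=> F2 G2; have := covariance_le F2 G2.
by rewrite /variance !covariance_rcov//= lee_fin.
Qed.

Lemma rcovE F G : F \in Lfun P 2%:E -> G \in Lfun P 2%:E ->
  rcov F G = fine (\int[P]_w (F w * G w)%:E) -
             fine (\int[P]_w (F w)%:E) * fine (\int[P]_w (G w)%:E).
Proof.
move=> F2 G2; have F1 := Lfun2_Lfun1 F2; have G1 := Lfun2_Lfun1 G2.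
have FG1 := Lfun2_mul_Lfun1 F2 G2.
rewrite /rcov covarianceE// fineB ?fin_numM ?expectation_fin_num//.
by rewrite fineM ?expectation_fin_num// !unlock.
Qed.

(** The mean is the best constant approximation in quadratic mean. *)
Lemma variance_le_sqr (F : T -> R) (s : R) : F \in Lfun P 2%:E ->
  ('V_P[F] <= \int[P]_w ((s - F w) ^+ 2)%:E)%E.
Proof.
move=> F2; rewrite -(varianceB_cst_l s F2).
have W2 : (cst s \- F) \in Lfun P 2%:E.
  have c2 : (cst s : T -> R) \in Lfun P 2%:E := Lfun_cst P s 2.
  by rewrite rpredB ?lee1n.
rewrite varianceE//.
have -> : ('E_P[(cst s \- F) ^+ 2] = \int[P]_w ((s - F w) ^+ 2)%:E)%E.
  by rewrite unlock.
rewrite -(fineK (expectation_fin_num (Lfun2_Lfun1 W2))) -EFin_expe leeBlDr//.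
by rewrite leeDl// lee_fin sqr_ge0.
Qed.

Lemma rcov_affine (a b a' b' : R) F G : F \in Lfun P 2%:E -> G \in Lfun P 2%:E ->
  rcov (fun w => F w * a + b) (fun w => G w * a' + b') = a * a' * rcov F G.
Proof.
move=> F2 G2.
have aff2 (H : T -> R) u v :
    H \in Lfun P 2%:E -> (fun w => H w * u + v) \in Lfun P 2%:E.
  move=> H2; rewrite -[X in X \in _]/((u \o* H) \+ cst v).
  have c2 : (cst v : T -> R) \in Lfun P 2%:E := Lfun_cst P v 2.
  have u2 : u \o* H \in Lfun P 2%:E by rewrite Lfun_scale ?ler1n.
  by rewrite rpredD ?lee1n.
have affl H K u v : H \in Lfun P 2%:E -> K \in Lfun P 2%:E ->
    rcov (fun w => H w * u + v) K = u * rcov H K.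
  move=> H2 K2; rewrite /rcov -[X in covariance P X _]/((u \o* H) \+ cst v).
  rewrite covarianceDl ?Lfun_cst// ?Lfun_scale ?ler1n// covariance_cst_l adde0.
  rewrite covarianceZl; [|exact: Lfun2_Lfun1..|exact: Lfun2_mul_Lfun1].
  by rewrite covariance_rcov.
have rcovC H K : rcov H K = rcov K H by rewrite /rcov covarianceC.
by rewrite affl// ?aff2// rcovC affl// rcovC mulrA.
Qed.

End Covariances.

Section Truncation.
Context d {T : measurableType d} {R : realType} (P : probability T R).
Implicit Types F G : T -> R.

(** The bound is [n.+1], not [n], so that every [clamp n] fixes 1. *)
Definition clamp (n : nat) (t : R) := Num.max (- n.+1%:R) (Num.min t n.+1%:R).

Lemma measurable_clamp n : measurable_fun [set: R] (clamp n).
Proof. by apply: measurable_maxr => //; exact: measurable_minr. Qed.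

Lemma clamp_id n t : `|t| <= n.+1%:R -> clamp n t = t.
Proof. by rewrite ler_norml /clamp => /andP[h1 h2]; rewrite min_l// max_r. Qed.

Lemma clamp_bounded n t : `|clamp n t| <= n.+1%:R.
Proof.
rewrite ler_norml /clamp le_max lexx/= ge_max ge_min lexx orbT andbT.
by rewrite (le_trans _ (ler0n R n.+1))// oppr_le0.
Qed.

Lemma clamp_le_norm n t : `|clamp n t| <= `|t|.
Proof.
have [h|h] := leP `|t| n.+1%:R; first by rewrite clamp_id.
by rewrite (le_trans (clamp_bounded n t))// ltW.
Qed.

Lemma cvg_clamp t : clamp n t @[n --> \oo] --> t.
Proof.
apply: cvg_near_cst; near=> n; apply: clamp_id.
apply: (@le_trans _ _ n%:R); last by rewrite ler_nat.
near: n; exact: nbhs_infty_ger.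
Unshelve. all: by end_near. Qed.

Lemma Lfun_measurable F (p : \bar R) : F \in Lfun P p -> measurable_fun [set: T] F.
Proof. by rewrite inE => /andP[/[!inE]/= mF _]. Qed.

Lemma Lfun_clamp n F : F \in Lfun P 2%:E -> clamp n \o F \in Lfun P 2%:E.
Proof.
move=> F2; apply: (@Lfun_bounded _ _ _ _ _ n.+1%:R) => [|w].
  apply: measurableT_comp; first exact: measurable_clamp.
  exact: Lfun_measurable F2.
exact: clamp_bounded.
Qed.

(** Dominated convergence, with bound [`|F G|]. *)
Lemma cvg_integral_clampM F G : F \in Lfun P 2%:E -> G \in Lfun P 2%:E ->
  fine (\int[P]_w ((clamp n (F w) * clamp n (G w))%:E))%E @[n --> \oo] -->
  fine (\int[P]_w (F w * G w)%:E)%E.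
Proof.
move=> F2 G2; have mF := Lfun_measurable F2; have mG := Lfun_measurable G2.
have FG1 := Lfun2_mul_Lfun1 F2 G2.
apply: fine_cvg; rewrite fineK; last first.
  by apply: integrable_fin_num => //; exact/Lfun1_integrable.
have mH n H : measurable_fun [set: T] H -> measurable_fun [set: T] (clamp n \o H).
  by move=> mH; apply: measurableT_comp => //; exact: measurable_clamp.
apply: (@dominated_cvg _ _ _ P setT measurableT _ _ (fun w => `|F w * G w|%:E)) => //.
- by move=> n; apply/measurable_EFinP; apply: measurable_funM; exact: mH.
- move=> w _; apply: cvg_EFin; first by near=> n.
  by apply: cvgM; exact: cvg_clamp.
- by apply/(Lfun1_integrable P (Num.norm \o (F \* G))); exact: Lfun_norm.
- by move=> n w _; rewrite lee_fin !normrM ler_pM// clamp_le_norm.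
Unshelve. all: by end_near. Qed.

Lemma cvg_rcov_clamp F G : F \in Lfun P 2%:E -> G \in Lfun P 2%:E ->
  rcov P (clamp n \o F) (clamp n \o G) @[n --> \oo] --> rcov P F G.
Proof.
move=> F2 G2; rewrite rcovE//.
under eq_fun do rewrite rcovE ?Lfun_clamp//.
(* the means are integrals of products with the constant 1 *)
have c2 : cst 1 \in Lfun P 2%:E := Lfun_cst P 1 2.
have cvgE H : H \in Lfun P 2%:E ->
    fine (\int[P]_w (clamp n (H w))%:E)%E @[n --> \oo] --> fine (\int[P]_w (H w)%:E)%E.
  move=> H2; have := cvg_integral_clampM H2 c2.
  under [in X in _ --> X -> _]eq_integral do rewrite mulr1.
  apply: cvg_trans; apply: near_eq_cvg; apply: nearW => n.
  congr fine; apply: eq_integral => w _.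
  by rewrite (@clamp_id n (cst 1 w)) ?mulr1// normr1 ler1n.
apply: cvgB; first exact: cvg_integral_clampM.
by apply: cvgM; exact: cvgE.
Qed.

End Truncation.

(** * Contraction in one step *)

Section OneStep.
Context {R : realType}.
Local Notation L := (measurableTypeR R).
Variables (C : R -> R -> R) (c : R * R -> R) (eps1 eps2 : R -> R).
Hypothesis Hc : ac_density C c.
Hypothesis eps1_ge0 : forall x, unit_itv x -> 0 <= eps1 x.
Hypothesis eps2_ge0 : forall x, unit_itv x -> 0 <= eps2 x.
Hypothesis eps1_L1 : (@lebesgue_measure R).-integrable unit_itv (EFin \o eps1).
Hypothesis eps2_L1 : (@lebesgue_measure R).-integrable unit_itv (EFin \o eps2).
Hypothesis c_ge : {ae @lebesgue2 R, forall z, unit_square z ->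
  eps1 z.1 + eps2 z.2 <= c z}.

Let e1 := fine (\int[@lebesgue_measure R]_(x in unit_itv) (eps1 x)%:E).
Let e2 := fine (\int[@lebesgue_measure R]_(x in unit_itv) (eps2 x)%:E).

(** Expand the variance of [f(U) - g(V)]. It is the integral of
    [psi = (f(x) - g(y) - s)^2] against the measure of the copula, with [s] its
    mean. On the line of abscissa [x] the integral of [psi] is at least the
    variance of [g(V)], whatever [x] and [s], and likewise on horizontal lines;
    so the weight [eps1 x] contributes at least [e1] times the variance of
    [g(V)], and [eps2 y] at least [e2] times that of [f(U)]. *)
Lemma one_step_covariance d (T : measurableType d) (P : probability T R)
    (U V : {RV P >-> R}) (f g : R -> R) :
    uniform01 U -> uniform01 V -> joint_cdf U V C ->
    measurable_fun [set: R] f -> unit_valued f ->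
    measurable_fun [set: R] g -> unit_valued g ->
  2 * rcov P (f \o U) (g \o V) <=
    (1 - e2) * rvar P (f \o U) + (1 - e1) * rvar P (g \o V).
Proof.
move=> uU uV UVC mf f01 mg g01.
have mfU : measurable_fun [set: T] (f \o U) by exact: measurableT_comp.
have mgV : measurable_fun [set: T] (g \o V) by exact: measurableT_comp.
have f2 : f \o U \in Lfun P 2%:E by apply: unit_valued_Lfun => // w; exact: f01.
have g2 : g \o V \in Lfun P 2%:E by apply: unit_valued_Lfun => // w; exact: g01.
have m1 : measurable_fun (unit_itv : set L) eps1.
  by apply/measurable_EFinP; exact: measurable_int eps1_L1.
have m2 : measurable_fun (unit_itv : set L) eps2.
  by apply/measurable_EFinP; exact: measurable_int eps2_L1.
pose s := fine ('E_P[(f \o U) \- (g \o V)])%E.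
pose psi (z : R * R) := (f z.1 - g z.2 - s) ^+ 2.
have mpsi : measurable_fun [set: R * R] psi.
  apply: measurable_funX; apply: measurable_funB => //.
  by apply: measurable_funB; exact: measurableT_comp.
have psi0 z : 0 <= psi z by exact: sqr_ge0.
have vf x : ((rvar P (g \o V))%:E <=
    \int[@lebesgue_measure R]_(y in unit_itv) (psi (x, y))%:E)%E.
  rewrite -(uniform01_integral (f := fun y => (psi (x, y))%:E) uV)//; last 2 first.
  - by apply/measurable_EFinP; exact: measurableT_comp.
  - by move=> y; rewrite lee_fin.
  rewrite -covariance_rcov//; apply: (le_trans (variance_le_sqr (f x - s) g2)).
  rewrite le_eqVlt; apply/orP; left; apply/eqP.
  by apply: eq_integral => w _; rewrite /psi/=; congr EFin; ring.
have vg y : ((rvar P (f \o U))%:E <=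
    \int[@lebesgue_measure R]_(x in unit_itv) (psi (x, y))%:E)%E.
  rewrite -(uniform01_integral (f := fun x => (psi (x, y))%:E) uU)//; last 2 first.
  - by apply/measurable_EFinP; apply: (measurableT_comp mpsi); exact: measurable_pair2.
  - by move=> x; rewrite lee_fin.
  rewrite -covariance_rcov//; apply: (le_trans (variance_le_sqr (g y + s) f2)).
  rewrite le_eqVlt; apply/orP; left; apply/eqP.
  by apply: eq_integral => w _; rewrite /psi/=; congr EFin; ring.
have [mu muC] := ac_density_integral_ge Hc eps1_ge0 eps2_ge0 m1 m2 c_ge mpsi
  psi0 (v1 := (rvar P (g \o V))%:E) (v2 := (rvar P (f \o U))%:E)
  (rvar_ge0 _ _) (rvar_ge0 _ _) vf vg.
have mEpsi : measurable_fun [set: R * R] (EFin \o psi) by exact/measurable_EFinP.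
have Epsi0 z : (0 <= (EFin \o psi) z)%E by rewrite lee_fin.
rewrite -(joint_law_integral uU uV UVC muC mEpsi Epsi0).
have -> : (\int[P]_w (EFin \o psi) (U w, V w) = variance P ((f \o U) \- (g \o V))%R)%E.
  rewrite /variance !unlock; apply: eq_integral => w _.
  by rewrite /psi /s unlock/= expr2.
have mIL : measurable (unit_itv : set L) by exact: measurable_unit_itv.
rewrite rvarB// -(fineK (integrable_fin_num mIL eps1_L1)).
rewrite -(fineK (integrable_fin_num mIL eps2_L1)).
rewrite -/e1 -/e2 -!EFinM -EFinD lee_fin; lra.
Qed.

End OneStep.

(** * Geometric decay of correlations *)

Section Decay.
Context d {T : measurableType d} {R : realType} (P : probability T R).
Variable X : int -> {RV P >-> R}.
Hypothesis HM : markov_chain X.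

Lemma rcov_markov (k : int) (F phi : T -> R) (f : R -> R) :
    measurable_wrt (sigma_of X [set i | i <= k]) F -> unit_valued F ->
    measurable_fun [set: R] f -> unit_valued f -> conditional_mean (X k) F f ->
    measurable_wrt (sigma_of X [set i | k <= i]) phi -> unit_valued phi ->
  rcov P F phi = rcov P (f \o X k) phi.
Proof.
move=> mF F01 mf f01 Ff mphi phi01.
have mFT := measurable_wrt_fun mF; have mphiT := measurable_wrt_fun mphi.
have mfX : measurable_fun [set: T] (f \o X k) by exact: measurableT_comp.
have F2 := unit_valued_Lfun P mFT F01.
have phi2 := unit_valued_Lfun P mphiT phi01.
have f2 : f \o X k \in Lfun P 2%:E by apply: unit_valued_Lfun => // w; exact: f01.
rewrite !rcovE// (markov_future HM mF F01 mf f01 Ff mphi); last first.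
  by move=> w; have /andP[] := phi01 w.
by have := Ff setT measurableT; rewrite preimage_setT => ->.
Qed.

Variables (e1 e2 q : R).
Hypothesis contraction : forall (k : int) (f g : R -> R),
  measurable_fun [set: R] f -> unit_valued f ->
  measurable_fun [set: R] g -> unit_valued g ->
  2 * rcov P (f \o X k) (g \o X (k + 1)) <=
    (1 - e2) * rvar P (f \o X k) + (1 - e1) * rvar P (g \o X (k + 1)).
Hypothesis e1_ge0 : 0 <= e1.
Hypothesis q_gt0 : 0 < q.
Hypothesis qE : 1 - e2 <= q * (1 + e1).

Lemma measurable_wrt_future_RV (k : int) (f : R -> R) : measurable_fun [set: R] f ->
  measurable_wrt (sigma_of X [set i | k <= i]) (f \o X k).
Proof.
by move=> mf; apply: measurable_wrt_comp => //; apply: measurable_wrt_RV => /=.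
Qed.

(** Let [f] and [g] be the regressions of [F] on [X n] and [X (n + 1)], of
    variances [v] and [v']. Then [v'] is the covariance of [F] and
    [g(X (n + 1))], hence by the Markov property that of [f(X n)] and
    [g(X (n + 1))]; the contraction hypothesis then reads
    [(1 + e1) v' <= (1 - e2) v]. *)
Lemma conditional_mean_variance_decay (F : T -> R) :
    measurable_wrt (sigma_of X [set i | i <= 0]) F -> unit_valued F ->
  forall n : nat, exists f : R -> R,
    [/\ measurable_fun [set: R] f, unit_valued f, conditional_mean (X n%:Z) F f &
        rvar P (f \o X n%:Z) <= q ^+ n * rvar P F].
Proof.
move=> mF F01; have mFT := measurable_wrt_fun mF.
have F2 := unit_valued_Lfun P mFT F01.
have mFn (n : nat) : measurable_wrt (sigma_of X [set i | i <= n%:Z]) F.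
  by apply: measurable_wrtS mF => i /= i0; apply: le_trans i0 _.
elim=> [|n [f [mf f01 Ff IHn]]].
  have [f [mf f01 Ff]] := exists_conditional_mean (X 0) mFT F01.
  exists f; split => //; rewrite expr0 mul1r.
  have fX01 : unit_valued (f \o X 0) by move=> w; exact: f01.
  have f2 : f \o X 0 \in Lfun P 2%:E.
    by apply: unit_valued_Lfun => //; exact: measurableT_comp.
  have := rcov_double_le F2 f2.
  rewrite (rcov_markov mF F01 mf f01 Ff (measurable_wrt_future_RV mf) fX01).
  by rewrite -/(rvar _ _); lra.
have n1 : n.+1%:Z = n%:Z + 1 by lia.
have [g [mg g01 Fg]] := exists_conditional_mean (X n.+1%:Z) mFT F01.
exists g; split => //.
have gX01 : unit_valued (g \o X n.+1%:Z) by move=> w; exact: g01.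
have vE : rvar P (g \o X n.+1%:Z) = rcov P (f \o X n%:Z) (g \o X n.+1%:Z).
  have mgX := measurable_wrt_future_RV (k := n.+1%:Z) mg.
  rewrite /rvar -(rcov_markov (mFn _) F01 mg g01 Fg mgX gX01).
  apply: (rcov_markov (mFn _)) => //.
  by apply: measurable_wrtS mgX => i /=; lia.
have := contraction n%:Z mf f01 mg g01; rewrite -n1 -vE.
have := rvar_ge0 P (f \o X n%:Z).
move: IHn vE; set v := rvar P (f \o _); set v' := rvar P (g \o _) => IHn vE v0 vv'.
have {vv'} vv' : v' <= q * v.
  have e1p : 0 < 1 + e1 by rewrite ltr_pwDl.
  rewrite -(ler_pM2l e1p); apply: (@le_trans _ _ ((1 - e2) * v)).
    by move: vv'; rewrite !mulrBl !mulrDl !mul1r; lra.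
  by rewrite mulrA [(1 + e1) * q]mulrC ler_wpM2r.
by apply: (le_trans vv'); rewrite exprS -mulrA ler_pM2l.
Qed.

Lemma rcov_decay_unit_valued (n : nat) (F G : T -> R) :
    measurable_wrt (sigma_of X [set i | i <= 0]) F -> unit_valued F ->
    measurable_wrt (sigma_of X [set i | n%:Z <= i]) G -> unit_valued G ->
  rcov P F G <= Num.sqrt q ^+ n * (Num.sqrt (rvar P F) * Num.sqrt (rvar P G)).
Proof.
move=> mF F01 mG G01.
have [f [mf f01 Ff fv]] := conditional_mean_variance_decay mF F01 n.
have mFn : measurable_wrt (sigma_of X [set i | i <= n%:Z]) F.
  by apply: measurable_wrtS mF => i /= i0; apply: le_trans i0 _.
rewrite (rcov_markov mFn F01 mf f01 Ff mG G01).
have G2 := unit_valued_Lfun P (measurable_wrt_fun mG) G01.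
have f2 : f \o X n%:Z \in Lfun P 2%:E.
  by apply: unit_valued_Lfun; [exact: measurableT_comp|move=> w; exact: f01].
apply: (le_trans (rcov_le_sqrt f2 G2)).
rewrite mulrA ler_wpM2r ?sqrtr_ge0//.
rewrite -(@ler_pXn2r _ 2)// ?nnegrE ?sqrtr_ge0 ?mulr_ge0 ?exprn_ge0 ?sqrtr_ge0//.
rewrite exprMn -exprM mulnC exprM !sqr_sqrtr ?rvar_ge0//; exact: ltW.
Qed.

(** Both sides are invariant under translations and scale in the same way, so
    bounded functions may be assumed to take their values in [0, 1]. *)
Lemma rcov_decay_bounded (n : nat) (F G : T -> R) (M : R) : 0 < M ->
    measurable_wrt (sigma_of X [set i | i <= 0]) F -> (forall w, `|F w| <= M) ->
    measurable_wrt (sigma_of X [set i | n%:Z <= i]) G -> (forall w, `|G w| <= M) ->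
  rcov P F G <= Num.sqrt q ^+ n * (Num.sqrt (rvar P F) * Num.sqrt (rvar P G)).
Proof.
move=> M0 mF FM mG GM.
pose h (t : R) := t * (M *+ 2)^-1 + 2^-1.
have M20 : 0 < (M *+ 2)^-1 by rewrite invr_gt0 pmulrn_lgt0.
have mh : measurable_fun [set: R] h.
  by apply: measurable_funD => //; exact: measurable_funM.
have h01 (H : T -> R) : (forall w, `|H w| <= M) -> unit_valued (h \o H).
  move=> HM' w; have := HM' w; rewrite ler_norml => /andP[H1 H2] /=.
  have -> : h (H w) = (H w + M) * (M *+ 2)^-1.
    by rewrite /h mulr2n; field; rewrite gt_eqF// addr_gt0.
  apply/andP; split; first by apply: mulr_ge0; [lra|exact: ltW].
  by rewrite ler_pdivrMr ?pmulrn_lgt0// mul1r mulr2n; lra.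
have F2 := Lfun_bounded P (measurable_wrt_fun mF) FM.
have G2 := Lfun_bounded P (measurable_wrt_fun mG) GM.
have := rcov_decay_unit_valued (measurable_wrt_comp mh mF) (h01 _ FM)
  (measurable_wrt_comp mh mG) (h01 _ GM).
rewrite /rvar !(rcov_affine _ _ _ _ F2 G2) !(rcov_affine _ _ _ _ F2 F2).
rewrite !(rcov_affine _ _ _ _ G2 G2).
set a := (M *+ 2)^-1; have aP : 0 < a by [].
have sqrt_a v : Num.sqrt (a * a * v) = a * Num.sqrt v.
  by rewrite -expr2 sqrtrM ?sqr_ge0// sqrtr_sqr gtr0_norm.
rewrite !sqrt_a; set u := Num.sqrt q ^+ n.
set sF := Num.sqrt (rcov P F F); set sG := Num.sqrt (rcov P G G).
rewrite (_ : u * (a * sF * (a * sG)) = a * a * (u * (sF * sG))); last by ring.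
by rewrite ler_pM2l// mulr_gt0.
Qed.

Lemma rcov_decay (n : nat) (F G : T -> R) :
    L2_of P (sigma_of X [set i | i <= 0]) F ->
    L2_of P (sigma_of X [set i | n%:Z <= i]) G ->
  rcov P F G <= Num.sqrt q ^+ n * (Num.sqrt (rvar P F) * Num.sqrt (rvar P G)).
Proof.
move=> [mF F2] [mG G2].
have cs H : H \in Lfun P 2%:E ->
    Num.sqrt (rvar P (clamp k \o H)) @[k --> \oo] --> Num.sqrt (rvar P H).
  move=> H2; apply: (cvg_comp _ _ (cvg_rcov_clamp H2 H2)).
  exact: sqrt_continuous.
apply: (ler_cvg_to (cvg_rcov_clamp F2 G2)).
  by apply: cvgM; [exact: cvg_cst|apply: cvgM; exact: cs].
apply: nearW => k; apply: (rcov_decay_bounded (M := k.+1%:R)) => //.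
- by apply: measurable_wrt_comp => //; exact: measurable_clamp.
- by move=> w; exact: clamp_bounded.
- by apply: measurable_wrt_comp => //; exact: measurable_clamp.
- by move=> w; exact: clamp_bounded.
Qed.

End Decay.

Lemma corr_le (R : realType) d (T : measurableType d) (P : probability T R)
    (F G : T -> R) (r : R) : 0 <= r ->
    rcov P F G <= r * (Num.sqrt (rvar P F) * Num.sqrt (rvar P G)) ->
  corr P F G <= r.
Proof.
move=> r0 FG; rewrite /corr -/(rcov P F G).
rewrite -[fine (variance P F)]/(rvar P F) -[fine (variance P G)]/(rvar P G).
have [s0|s0] := eqVneq (Num.sqrt (rvar P F) * Num.sqrt (rvar P G)) 0.
  by rewrite s0 invr0 mulr0.
rewrite ler_pdivrMr// lt_neqAle eq_sym s0 mulr_ge0 ?sqrtr_ge0//.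
Qed.

Theorem theorem2 (R : realType) (C : R -> R -> R) (c : R * R -> R)
    (eps1 eps2 : R -> R)
    (HC : copula C) (Hc : ac_density C c)
    (eps1_ge0 : forall x, unit_itv x -> 0 <= eps1 x)
    (eps2_ge0 : forall x, unit_itv x -> 0 <= eps2 x)
    (eps1_L1 : (@lebesgue_measure R).-integrable unit_itv (EFin \o eps1))
    (eps2_L1 : (@lebesgue_measure R).-integrable unit_itv (EFin \o eps2))
    (eps_neq0 :
      (\int[@lebesgue_measure R]_(x in unit_itv) (eps1 x)%:E <> 0)%E \/
      (\int[@lebesgue_measure R]_(x in unit_itv) (eps2 x)%:E <> 0)%E)
    (c_ge : {ae @lebesgue2 R, forall z, unit_square z ->
              eps1 z.1 + eps2 z.2 <= c z})
    (d : measure_display) (T : measurableType d) (P : probability T R)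
    (X : int -> {RV P >-> R}) (HX : generated_by C X) :
  exponentially_rho_mixing X.
Proof.
case: HX => _ HM Xunif Xjoint.
have mI : measurable (unit_itv : set (measurableTypeR R)) by exact: measurable_unit_itv.
pose e1 := fine (\int[@lebesgue_measure R]_(x in unit_itv) (eps1 x)%:E)%E.
pose e2 := fine (\int[@lebesgue_measure R]_(x in unit_itv) (eps2 x)%:E)%E.
have e1_ge0 : 0 <= e1.
  by apply: fine_ge0; apply: integral_ge0 => x Ix; rewrite lee_fin; exact: eps1_ge0.
have e2_ge0 : 0 <= e2.
  by apply: fine_ge0; apply: integral_ge0 => x Ix; rewrite lee_fin; exact: eps2_ge0.
have e_gt0 : 0 < e1 + e2.
  rewrite lt_neqAle addr_ge0// andbT eq_sym paddr_eq0//.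
  apply/negP => /andP[/eqP e10 /eqP e20]; case: eps_neq0.
  - by rewrite -(fineK (integrable_fin_num mI eps1_L1)) -/e1 e10.
  - by rewrite -(fineK (integrable_fin_num mI eps2_L1)) -/e2 e20.
have e1p : 0 < 1 + e1 by rewrite ltr_pwDl.
(* [(1 - e2) / (1 + e1)] is the contraction ratio; it may be 0, hence the max *)
pose q := Num.max 2^-1 ((1 - e2) / (1 + e1)).
have q_gt0 : 0 < q by rewrite lt_max invr_gt0 ltr0n.
have q_lt1 : q < 1.
  rewrite gt_max invf_lt1 ?ltr1n//= ltr_pdivrMr// mul1r.
  by rewrite ltrBlDr -addrA ltrDl.
have qE : 1 - e2 <= q * (1 + e1) by rewrite -ler_pdivrMr// le_max lexx orbT.
exists 1, (Num.sqrt q); split.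
  by rewrite sqrtr_gt0 q_gt0/= -[ltRHS]sqrtr1 ltr_sqrt.
move=> n _; rewrite mul1r; apply: ge_ereal_sup => _ [F pF [G pG <-]].
rewrite lee_fin; apply: corr_le; first by rewrite exprn_ge0// sqrtr_ge0.
apply: (@rcov_decay _ _ _ P X HM e1 e2 q) => // k f g mf f01 mg g01.
exact: (one_step_covariance Hc eps1_ge0 eps2_ge0 eps1_L1 eps2_L1 c_ge).
Qed.
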